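(* Let $\Omega\subseteq\mathbb{R}^n$ be open, and let $\mathbb{I}=(I,\le,\mathcal{I})$ be a set of indices which, together with $\mathcal{J}\subseteq\mathcal{I}$, a map $\varepsilon\mapsto\underline\varepsilon$ and a map $\varepsilon\mapsto\Omega_\varepsilon$, satisfies assumptions (A1)–(A4) of the context. Let $u\in\mathcal{G}^{\mathbb{I}}(\Omega)$. Then: (i) if $x\in\widetilde{\Omega}_c^{\mathbb{I}}$, then $u(x)$ is a well-defined element of $\widetilde{\mathbb{R}}^{\mathbb{I}}$; (ii) $u=0$ in $\mathcal{G}^{\mathbb{I}}(\Omega)$ if and only if $u(x)=0$ in $\widetilde{\mathbb{R}}^{\mathbb{I}}$ for all $x\in\widetilde{\Omega}_c^{\mathbb{I}}$.
   Context: $\mathbb{N}=\{0,1,2,\dots\}$; $K\Subset\Omega$ means that $K$ is a compact subset of $\Omega$. Set of indices: $\mathbb{I}=(I,\le,\mathcal{I})$ is a set of indices if $(I,\le)$ is a non-empty pre-ordered set (reflexive and transitive relation); $\mathcal{I}$ is a set of subsets of $I$ with $\emptyset\notin\mathcal{I}$ and $I\in\mathcal{I}$; for all $A,B\in\mathcal{I}$ there is $C\in\mathcal{I}$ with $C\subseteq A\cap B$; and, writing $A_{\le e}:=\{\varepsilon\in A\mid\varepsilon\le e\}$ and $\varepsilon<e$ for ''$\varepsilon\le e$ and $\varepsilon\ne e$'', whenever $e\le a\in A\in\mathcal{I}$ the set $A_{\le e}$ is non-empty and for all $b,c\in A_{\le e}$ there is $d\in A_{\le e}$ with $d<b$ and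 $d<c$. Big-O: for $a\in A\in\mathcal{I}$ and nets $(x_\varepsilon),(y_\varepsilon)$ indexed by $I$, $x_\varepsilon=O_{a,A}(y_\varepsilon)$ means $\exists H\in\mathbb{R}_{>0}\,\exists\varepsilon_0\in A_{\le a}\,\forall\varepsilon\in A_{\le\varepsilon_0}:\ |x_\varepsilon|\le H|y_\varepsilon|$. For $\mathcal{J}\subseteq\mathcal{I}$, $x_\varepsilon=O_{\mathcal{J}}(y_\varepsilon)$ means $\exists A\in\mathcal{J}\,\forall a\in A:\ x_\varepsilon=O_{a,A}(y_\varepsilon)$; and $O:=O_{\mathcal{I}}$. A sequence $(z_k)_{k\in\mathbb{N}}$ of $A_{\le a}$ tends to $\emptyset$ in $A_{\le a}$ if $\forall\varepsilon_0\in A_{\le a}\,\exists K\in\mathbb{N}\,\forall k\ge K:\ z_k<\varepsilon_0$. Assumptions: (A1) For each $a\in A\in\mathcal{I}$ there exists a sequence of $A_{\le a}$ which tends to $\emptyset$ in $A_{\le a}$; moreover, for all $b,c\in A_{\le a}$, $b<c$ or $c\le b$. (A2) $\mathcal{J}\subseteq\mathcal{I}$ is non-empty and for all $A,B\in\mathcal{J}$ there is $C\in\mathcal{J}$ with $C\subseteq A\cap B$. (A3) There is a map $I\to(0,1]$, $\varepsilon\mapsto\underline\varepsilon$, such that $\exists A\in\mathcal{I}\,\forall a\in A:\ \lim_{\varepsilon\in A_{\le a}}\underline\varepsilon=0$ (limit along the downward directed set $A_{\le a}$). (A4) A map $\varepsilon\mapsto\Omega_\varepsilon$ is given, where $\Omega_\varepsilon$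 is an open subset of $\mathbb{R}^n$ for each $\varepsilon\in I$. Generalized functions: $\mathcal{E}^{\mathbb{I}}(\Omega)$ is the set of families $u=(u_\varepsilon)_{\varepsilon\in I}$ with $u_\varepsilon\in\mathcal{C}^\infty(\Omega_\varepsilon,\mathbb{R})$ for all $\varepsilon\in I$. $u\in\mathcal{E}_M^{\mathbb{I}}(\Omega)$ iff $u\in\mathcal{E}^{\mathbb{I}}(\Omega)$ and $\forall K\Subset\Omega\,\forall\alpha\in\mathbb{N}^n\,\exists N\in\mathbb{N}:\ \sup_{x\in K}|\partial^\alpha u_\varepsilon(x)|=O_{\mathcal{J}}(\underline\varepsilon^{-N})$. If $u\in\mathcal{E}_M^{\mathbb{I}}(\Omega)$, then $u\in\mathcal{N}^{\mathbb{I}}(\Omega)$ iff $\forall K\Subset\Omega\,\forall m\in\mathbb{N}:\ \sup_{x\in K}|u_\varepsilon(x)|=O(\underline\varepsilon^{m})$. $\mathcal{G}^{\mathbb{I}}(\Omega):=\mathcal{E}_M^{\mathbb{I}}(\Omega)/\mathcal{N}^{\mathbb{I}}(\Omega)$. Generalized points: $\Omega_M^{\mathbb{I}}:=\{(x_\varepsilon)\in\Omega^I\mid\exists N\in\mathbb{N}:\ x_\varepsilon=O_{\mathcal{J}}(\underline\varepsilon^{-N})\}$; for $(x_\varepsilon),(y_\varepsilon)\in\Omega_M^{\mathbb{I}}$, $(x_\varepsilon)\sim_{\mathbb{I}}(y_\varepsilon)$ iff $\forall m\in\mathbb{N}:\ x_\varepsilon-y_\varepsilon=O(\underline\varepsilon^{m})$;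 $\widetilde\Omega^{\mathbb{I}}:=\Omega_M^{\mathbb{I}}/\sim_{\mathbb{I}}$. $\widetilde{\mathbb{R}}^{\mathbb{I}}$ is the same construction with $\mathbb{R}$ in place of $\Omega$. For a property $\mathcal{P}(\varepsilon)$, $\forall^{\mathbb{I}}\varepsilon:\mathcal{P}(\varepsilon)$ (''for $\varepsilon\in\mathbb{I}$ sufficiently small $\mathcal{P}(\varepsilon)$ holds'') means $\exists A\in\mathcal{I}\,\forall a\in A\,\exists\varepsilon_0\le a\,\forall\varepsilon\in A_{\le\varepsilon_0}:\ \mathcal{P}(\varepsilon)$. $[x_\varepsilon]\in\widetilde\Omega_c^{\mathbb{I}}$ iff $[x_\varepsilon]\in\widetilde\Omega^{\mathbb{I}}$ and $\exists K\Subset\Omega\,\forall^{\mathbb{I}}\varepsilon:\ x_\varepsilon\in K$. For $u=[u_\varepsilon]\in\mathcal{G}^{\mathbb{I}}(\Omega)$ and $x=[x_\varepsilon]\in\widetilde\Omega_c^{\mathbb{I}}$, $u(x):=[u_\varepsilon(x_\varepsilon)]$.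
   Formalization: Moderate u must satisfy K⊆Ω_ε for small ε w.r.t. 𝒥; as u_ε(x_ε) need not be moderate for every representative when 𝒥≠𝓘, [u_ε(x_ε)] means the moderate nets equivalent to it, and moderateness of u_ε(x_ε) is claimed only for some representatives. *)

(* Defs.v *)
From mathcomp Require Export all_boot all_order all_algebra.
From mathcomp Require Export all_classical all_reals all_analysis.

Set Implicit Arguments.
Unset Strict Implicit.
Unset Printing Implicit Defensive.

Import Order.TTheory GRing.Theory Num.Theory.
Import numFieldNormedType.Exports.

Local Open Scope classical_set_scope.
Local Open Scope ring_scope.

Section Indices.
Context {d : Order.disp_t} {I : preorderType d}.
Implicit Types (A : set I) (F cI cJ : set (set I)) (P : I -> Prop).

Definition below A (a : I) : set I := [set e | A e /\ (e <= a)%O].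

(* On a preorder this is weaker than the library's [<], which excludes
   [b <= a]; here antisymmetry is not available and "strict" only means
   "different". *)
Definition slt (a b : I) : Prop := (a <= b)%O /\ a <> b.

Record index_set cI : Prop := IndexSet {
  index_nonempty : [set: I] !=set0;
  index_no_set0 : ~ cI set0;
  index_full : cI setT;
  index_meet : forall A B, cI A -> cI B ->
    exists2 C, cI C & C `<=` A `&` B;
  index_below : forall A a e, cI A -> A a -> (e <= a)%O ->
    below A e !=set0;
  index_directed : forall A a e, cI A -> A a -> (e <= a)%O ->
    forall b c, below A e b -> below A e c ->
      exists x, [/\ below A e x, slt x b & slt x c]
}.

Definition tends_to_empty A a (z : nat -> I) : Prop :=
  (forall k, below A a (z k)) /\
  (forall e0, below A a e0 ->
    exists K : nat, forall k : nat, (K <= k)%N -> slt (z k) e0).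

Definition sequential_indices cI : Prop :=
  forall A a, cI A -> A a ->
    (exists z, tends_to_empty A a z) /\
    (forall b c, below A a b -> below A a c -> slt b c \/ (c <= b)%O).

Definition directed_subfamily cI cJ : Prop :=
  [/\ cJ `<=` cI, cJ !=set0 &
      forall A B, cJ A -> cJ B -> exists2 C, cJ C & C `<=` A `&` B].

Definition for_small F P : Prop :=
  exists2 A, F A & forall a, A a ->
    exists2 e0, (e0 <= a)%O & forall e, below A e0 e -> P e.

End Indices.

Section Asymptotics.
Context {R : realType} {d : Order.disp_t} {I : preorderType d}.
Implicit Types (A : set I) (cI cJ F : set (set I)) (rho : I -> R).

(* [rho e] is the "underlined" epsilon; the filter is the one generated by the
   sections of the downward directed set [below A a]. *)
Definition gauge cI rho : Prop :=
  (forall e, 0 < rho e <= 1) /\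
  (exists2 A, cI A & forall a, A a ->
    rho @ filter_from (below A a) (below A) --> (0 : R)).

Definition bigO_at {V : normedModType R} A a (x : I -> V) (y : I -> R) : Prop :=
  exists2 H : R, 0 < H & exists2 e0, below A a e0 &
    forall e, below A e0 e -> `|x e| <= H * `|y e|.

Definition is_bigO {V : normedModType R} F (x : I -> V) (y : I -> R) : Prop :=
  exists2 A, F A & forall a, A a -> bigO_at A a x y.

(* The norm of 'rV[R]_n is the max norm; being equivalent to the Euclidean one,
   it yields the same O-relations. *)
Definition moderate_point {V : normedModType R} cJ rho (D : set V)
    (x : I -> V) : Prop :=
  (forall e, D (x e)) /\ exists N : nat, is_bigO cJ x (fun e => rho e ^- N).

Definition equiv_point {V : normedModType R} cI rho (x y : I -> V) : Prop :=
  forall m : nat, is_bigO cI (fun e => x e - y e) (fun e => rho e ^+ m).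

(* The class [x] as a set of nets, defined for an arbitrary net [x]: it is an
   element of [gen_points] exactly when [x] is equivalent to some moderate
   net.  A net equivalent to a moderate one is moderate if [cJ = cI], but not
   in general. *)
Definition point_class {V : normedModType R} cI cJ rho (D : set V)
    (x : I -> V) : set (I -> V) :=
  [set y | moderate_point cJ rho D y /\ equiv_point cI rho x y].

Definition gen_points {V : normedModType R} cI cJ rho (D : set V) :
    set (set (I -> V)) :=
  [set X | exists2 x, moderate_point cJ rho D x &
                      X = point_class cI cJ rho D x].

Definition gen_reals cI cJ rho : set (set (I -> R)) :=
  gen_points cI cJ rho [set: R].

Definition real_class cI cJ rho (x : I -> R) : set (I -> R) :=
  point_class cI cJ rho [set: R] x.

End Asymptotics.

Section Smooth.
Context {R : realType} {n : nat}.
Implicit Types (f : 'rV[R]_n -> R) (U K : set 'rV[R]_n).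

(* [iter_partial [:: i1; ...; ik] f] is d_{i1} ... d_{ik} f. *)
Fixpoint iter_partial (s : seq 'I_n) f : 'rV[R]_n -> R :=
  if s is i :: s' then 'D_(delta_mx 0 i) (iter_partial s' f) else f.

Definition partial (alpha : 'I_n -> nat) f : 'rV[R]_n -> R :=
  iter_partial (flatten [seq nseq (alpha i) i | i <- enum 'I_n]) f.

(* [f] is only meaningful on the open set [U]: it is a total function
   representing an element of C^oo(U), with irrelevant values outside [U]. *)
Definition smooth_on U f : Prop :=
  forall (s : seq 'I_n) x, U x ->
    {for x, continuous (iter_partial s f)} /\
    (forall i, derivable (iter_partial s f) x (delta_mx 0 i)).

Definition compact_in K U : Prop := compact K /\ K `<=` U.

Definition sup_on K f : R := sup [set `|f x| | x in K].

End Smooth.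

Section GeneralizedFunctions.
Context {R : realType} {n : nat} {d : Order.disp_t} {I : preorderType d}.
Variables (cI cJ : set (set I)) (rho : I -> R).
Variables (Omega : set 'rV[R]_n) (Omegae : I -> set 'rV[R]_n).
Implicit Types (u v : I -> 'rV[R]_n -> R) (x : I -> 'rV[R]_n).

(* The supremum over [K] of a derivative of [u e] is defined only if [K] lies
   in the domain [Omegae e] of [u e].  The O-estimate on these suprema thus
   includes that [K `<=` Omegae e] for small [e]; as [sup_on] is total, this
   is stated explicitly. *)
Definition moderate_fun u : Prop :=
  (forall e, smooth_on (Omegae e) (u e)) /\
  (forall K, compact_in K Omega ->
    for_small cJ (fun e => K `<=` Omegae e) /\
    (forall alpha : 'I_n -> nat, exists N : nat,
      is_bigO cJ (fun e => sup_on K (partial alpha (u e)))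
                 (fun e => rho e ^- N))).

Definition negligible_fun u : Prop :=
  moderate_fun u /\
  (forall K, compact_in K Omega -> forall m : nat,
    is_bigO cI (fun e => sup_on K (u e)) (fun e => rho e ^+ m)).

Definition fun_class u : set (I -> 'rV[R]_n -> R) :=
  [set v | moderate_fun v /\ negligible_fun (fun e y => v e y - u e y)].

Definition gen_functions : set (set (I -> 'rV[R]_n -> R)) :=
  [set U | exists2 u, moderate_fun u & U = fun_class u].

Definition compact_points : set (set (I -> 'rV[R]_n)) :=
  [set X | exists x, [/\ moderate_point cJ rho Omega x,
     X = point_class cI cJ rho Omega x &
     exists2 K, compact_in K Omega & for_small cI (fun e => K (x e))]].

Definition eval_net u x : I -> R := fun e => u e (x e).

(* [Y] is "the" value of the generalized function [U] at the generalized point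
   [X]: all representatives [u] of [U] and [x] of [X] give the class [Y], and
   for some of them the net [u e (x e)] is itself moderate, so that [Y] is an
   element of [gen_reals].  Moderateness cannot be required for all of them
   when [cJ <> cI]: the point [x e] is only known to lie in a compact set for
   [e] small with respect to [cI]. *)
Definition is_value (U : set (I -> 'rV[R]_n -> R)) (X : set (I -> 'rV[R]_n))
    (Y : set (I -> R)) : Prop :=
  (exists u x, [/\ U u, X x &
     moderate_point cJ rho [set: R] (eval_net u x)]) /\
  (forall u x, U u -> X x -> real_class cI cJ rho (eval_net u x) = Y).

End GeneralizedFunctions.

(* Main.v *)
Require Import Defs.
From mathcomp Require Import all_boot all_order all_algebra.
From mathcomp Require Import all_classical all_reals all_analysis.
Import Order.TTheory GRing.Theory Num.Theory.
Import numFieldNormedType.Exports.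
Local Open Scope classical_set_scope.
Local Open Scope ring_scope.

Set Implicit Arguments.
Unset Strict Implicit.
Unset Printing Implicit Defensive.

(** Part (i) rests on two estimates.  A generalized point with compact support
    has a representative [x] all of whose values lie in one compact set
    [K `<=` Omega], and then [`|u e (x e)|] is at most the supremum of [u e]
    over [K], which is moderate.  Any other representative [y] stays, for small
    indices, in a compact thickening [L] of [K] inside [Omega], because the
    gauge tends to 0.  Changing [u] into another representative changes the
    value by at most the supremum over [L] of a negligible net; changing [x]
    into [y] changes it, by the mean value inequality, by at most the suprema
    over [L] of the first-order partial derivatives of [u e], which are
    [O(rho^-N)], times [`|y e - x e|], which is [O(rho^(m + N))] for every [m].
    The lemma [eval_net_well_defined] combines the two.

    For the nontrivial half of part (ii), let [x e] be a point of [K] where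
    [`|u e|] attains its maximum over [K].  The net [x] represents a compactly
    supported point, and the vanishing of [u] there says precisely that the
    suprema of [u e] over [K] are [O(rho^m)] for every [m]; see
    [negligible_of_zero_values]. *)

(** * Mean value inequality and compact thickenings *)

(** The mean value inequality, for endpoints in either order. *)
Lemma bounded_increment {R : realType} (g dg : R -> R) (a b M : R) :
  (forall t, Num.min a b <= t <= Num.max a b -> is_derive t 1 g (dg t)) ->
  (forall t, Num.min a b <= t <= Num.max a b -> `|dg t| <= M) ->
  `|g b - g a| <= M * `|b - a|.
Proof.
wlog ab : a b / a <= b => [WL|].
  have [ab dgP MP|ba dgP MP] := orP (le_total a b); first exact: WL.
  by rewrite distrC (distrC b); apply: WL => // t; rewrite minC maxC;
    [exact: dgP|exact: MP].
rewrite min_l// max_r// => dgP MP.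
have dgab t : t \in `[a, b]%R -> is_derive t 1 g (dg t).
  by rewrite in_itv/= => /dgP.
have gc : {within `[a, b], continuous g}.
  by apply: derivable_within_continuous => t /dgab [].
have dgo t : t \in `]a, b[%R -> is_derive t 1 g (dg t).
  by move=> /subset_itv_oo_cc /dgab.
have [c cab E] := MVT_segment ab dgo gc.
by rewrite E normrM ler_wpM2r// MP// -in_itv.
Qed.

Lemma derivable_line {R : realType} {V : normedModType R} (f : V -> R)
    (p v : V) (t : R) :
  derivable f (p + t *: v) v ->
  is_derive t 1 (fun s : R => f (p + s *: v)) ('D_v f (p + t *: v)).
Proof.
move=> df.
have E : (fun h : R => h^-1 *: (f (h *: v + (p + t *: v)) - f (p + t *: v))) =
  (fun h : R => h^-1 *: ((fun s : R => f (p + s *: v)) (h *: (1 : R) + t) -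
     (fun s : R => f (p + s *: v)) t)).
  apply/funext => h /=; congr (_ *: (f _ - _)).
  by rewrite -[h *: (1 : R)]/(h * 1) mulr1 scalerDl addrCA.
split.
  by move: df; rewrite /derivable E.
by rewrite /derive E.
Qed.

Lemma normr_coord_le {R : realType} {n : nat} (z : 'rV[R]_n) (i : 'I_n) :
  `|z 0 i| <= `|z|.
Proof.
rewrite [leRHS]/Num.norm/= mx_normrE; apply/bigmax_geP; right.
by exists (0, i).
Qed.

Lemma normr_row_le {R : realType} {n : nat} (z : 'rV[R]_n) (c : R) :
  0 <= c -> (forall i, `|z 0 i| <= c) -> `|z| <= c.
Proof.
move=> c0 zc; rewrite [leLHS]/Num.norm/= mx_normrE; apply/bigmax_leP.
by split=> // -[i j] _ /=; rewrite (ord1 i).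
Qed.

(** The segments joining [x] to [y] by changing one coordinate at a time stay in
    the closed ball of radius [`|y - x|] around [x], since the norm is the max
    norm.  Hence partial derivatives suffice: no total differentiability is
    needed. *)
Lemma coordinatewise_mean_value {R : realType} {n : nat} (f : 'rV[R]_n -> R)
    (x y : 'rV[R]_n) (M : 'I_n -> R) :
  (forall z, `|z - x| <= `|y - x| -> forall i,
     derivable f z (delta_mx 0 i) /\ `|'D_(delta_mx 0 i) f z| <= M i) ->
  `|f y - f x| <= (\sum_i M i) * `|y - x|.
Proof.
move=> dfM.
(* [p k] has the first [k] coordinates of [y] and the others of [x]. *)
pose p k : 'rV[R]_n := \row_j (if (j < k)%N then y 0 j else x 0 j).
have p0 : p 0 = x by apply/rowP => j; rewrite mxE.
have pn : p n = y by apply/rowP => j; rewrite mxE ltn_ord.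
have pS (i : 'I_n) : p i.+1 = p i + (y 0 i - x 0 i) *: delta_mx 0 i.
  apply/rowP => j; rewrite !mxE eqxx/= ltnS.
  have [->|ji] := eqVneq j i.
    by rewrite leqnn ltnn mulr1 addrC subrK.
  by rewrite mulr0 addr0 ltn_neqAle; move: ji; rewrite -val_eqE/= => ->.
have pball (i : 'I_n) t :
    Num.min 0 (y 0 i - x 0 i) <= t <= Num.max 0 (y 0 i - x 0 i) ->
    `|p i + t *: delta_mx 0 i - x| <= `|y - x|.
  move=> /andP[t1 t2].
  have tyx : `|t| <= `|y 0 i - x 0 i|.
    rewrite ler_norml; apply/andP; split.
      apply: le_trans t1; rewrite le_min oppr_le0 normr_ge0/=.
      by rewrite lerNl -normrN ler_norm.
    by apply: le_trans t2 _; rewrite ge_max normr_ge0 ler_norm.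
  apply: normr_row_le => // j; rewrite !mxE eqxx/=.
  have [->|ji] := eqVneq j i.
    rewrite ltnn mulr1 addrAC subrr add0r (le_trans tyx)//.
    by have := normr_coord_le (y - x) i; rewrite !mxE.
  rewrite mulr0 addr0; case: ifP => _; last by rewrite subrr normr0.
  by have := normr_coord_le (y - x) j; rewrite !mxE.
have step (i : 'I_n) : `|f (p i.+1) - f (p i)| <= M i * `|y - x|.
  have := @bounded_increment R (fun s => f (p i + s *: delta_mx 0 i))
    (fun s => 'D_(delta_mx 0 i) f (p i + s *: delta_mx 0 i))
    0 (y 0 i - x 0 i) (M i).
  rewrite scale0r addr0 -pS subr0 => H; apply: le_trans (H _ _) _.
  - move=> t /pball tP; apply: derivable_line.
    by have [] := dfM _ tP i.
  - by move=> t /pball tP; have [] := dfM _ tP i.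
  - rewrite ler_wpM2l//.
      have [|_] := dfM x _ i; first by rewrite subrr normr0.
      by apply: le_trans.
    by have := normr_coord_le (y - x) i; rewrite !mxE.
rewrite -{1}pn -{1}p0 -(telescope_sumr (fun k => f (p k)) (leq0n n)) big_mkord.
by rewrite (le_trans (ler_norm_sum _ _ _))// mulr_suml ler_sum.
Qed.

(** The thickening of [K] is the sum of [K] and a small closed ball; its radius
    exists because [K] is compact and contained in the open set [D]. *)
Lemma compact_thickening {R : realType} {n : nat} (K D : set 'rV[R]_n) :
  open D -> compact_in K D ->
  exists2 r : R, 0 < r & exists2 L, compact_in L D &
    forall x y, K x -> `|y - x| <= r -> L y.
Proof.
move=> oD [cK KD].
have [r r0 rP] : exists2 r : R, 0 < r &
    forall x, K x -> forall y, `|y - x| < r -> D y.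
  have : \forall r \near (0 : R), forall x, K x ->
      forall y, `|y - x| < r -> D y.
    move/compact_near_coveringP : (cK) => cov.
    apply: (cov R (nbhs 0) (fun r x => forall y, `|y - x| < r -> D y)) => x Kx.
    have /nbhs_ballP[s /= s0 sD] : nbhs x D.
      by apply: open_nbhs_nbhs; split => //; exact: KD.
    have s20 : 0 < s / 2 by rewrite divr_gt0.
    exists (ball x (s / 2), ball 0 (s / 2)).
      by split; [exact: nbhsx_ballx|exact: (nbhsx_ballx (0 : R))].
    move=> [x' r] /= [xx' rs] y yr; apply: sD.
    move: xx' rs; rewrite -!ball_normE/= sub0r normrN => xx' rs.
    rewrite -(subrKA x') (le_lt_trans (ler_normD _ _))//.
    rewrite (splitr s) ltrD// distrC (lt_le_trans yr)//.
    by rewrite (le_trans (ler_norm _))// ltW.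
  move=> /nbhs_ballP[s /= s0 sP]; exists (s / 2); first by rewrite divr_gt0.
  apply: sP; rewrite -ball_normE/= sub0r normrN gtr0_norm ?divr_gt0//.
  by rewrite gtr_pMr// invf_lt1// ltr1n.
exists (r / 2); first by rewrite divr_gt0.
pose B : set 'rV[R]_n := closed_ball_ (fun z => `|z|) 0 (r / 2).
have cB : compact B.
  apply: bounded_closed_compact; last exact: closed_closed_ball_.
  exists (r / 2); split; first exact: num_real.
  move=> M rM z; rewrite /B /closed_ball_/= sub0r normrN => zr.
  by rewrite (le_trans zr)// ltW.
exists ((fun z : 'rV[R]_n * 'rV[R]_n => z.1 + z.2) @` (K `*` B)); last first.
  move=> x y Kx yx; exists (x, y - x); last by rewrite /= addrC subrK.
  by split => //=; rewrite /B /closed_ball_/= sub0r normrN.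
split.
  apply: continuous_compact; last exact: compact_setX.
  by apply: continuous_subspaceT => z; exact: add_continuous.
move=> _ [[x z] /= [Kx Bz] <-]; apply: (rP x Kx).
rewrite addrAC subrr add0r.
move: Bz; rewrite /B /closed_ball_/= sub0r normrN => /le_lt_trans -> //.
by rewrite gtr_pMr// invf_lt1// ltr1n.
Qed.

(** * Smooth functions and their suprema *)

Lemma iter_partial0 {R : realType} {n : nat} (s : seq 'I_n) :
  iter_partial s (fun _ : 'rV[R]_n => 0 : R) = (fun _ => 0).
Proof.
by elim: s => //= i s ->; apply/funext => x; rewrite (derive_cst (0 : R)).
Qed.

Lemma smooth_on0 {R : realType} {n : nat} (D : set 'rV[R]_n) :
  smooth_on D (fun _ => 0).
Proof.
move=> s x _; rewrite iter_partial0; split; first exact: cst_continuous.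
by move=> i; exact: derivable_cst.
Qed.

(** Outside [D] the functions are arbitrary, so linearity is asserted only on
    [D]; openness makes the derivatives at a point of [D] depend only on values
    in [D]. *)
Lemma iter_partialB {R : realType} {n : nat} (D : set 'rV[R]_n)
    (f g : 'rV[R]_n -> R) (s : seq 'I_n) (x : 'rV[R]_n) :
  open D -> smooth_on D f -> smooth_on D g -> D x ->
  iter_partial s (fun y => f y - g y) x =
  iter_partial s f x - iter_partial s g x.
Proof.
move=> oD sf sg; elim: s x => //= i s IH x Dx.
have [_ /(_ i) df] := sf s x Dx; have [_ /(_ i) dg] := sg s x Dx.
rewrite -(deriveB df dg); apply: near_eq_derive.
have : \forall y \near x, D y by apply: open_nbhs_nbhs.
by apply: filterS => y; exact: IH.
Qed.

Lemma smooth_onB {R : realType} {n : nat} (D : set 'rV[R]_n)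
    (f g : 'rV[R]_n -> R) :
  open D -> smooth_on D f -> smooth_on D g ->
  smooth_on D (fun y => f y - g y).
Proof.
move=> oD sf sg s x Dx.
have [cf df] := sf s x Dx; have [cg dg] := sg s x Dx.
have E : \forall y \near x, iter_partial s f y - iter_partial s g y =
    iter_partial s (fun z => f z - g z) y.
  have : \forall y \near x, D y by apply: open_nbhs_nbhs.
  by apply: filterS => y Dy; rewrite (iter_partialB s oD sf sg).
split.
  suff : iter_partial s (fun y => f y - g y) @ x -->
      iter_partial s (fun y => f y - g y) x by [].
  rewrite (iter_partialB s oD sf sg)//.
  exact: cvg_trans (near_eq_cvg E) (cvgB cf cg).
by move=> i; apply: (near_eq_derivable E); exact: derivableB.
Qed.

Lemma smooth_on_continuous {R : realType} {n : nat} (D K : set 'rV[R]_n)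
    (f : 'rV[R]_n -> R) (s : seq 'I_n) :
  smooth_on D f -> K `<=` D -> forall x, K x ->
  {for x, continuous (iter_partial s f)}.
Proof. by move=> sf KD x /KD /(sf s) []. Qed.

Lemma partial_nil {R : realType} {n : nat} (f : 'rV[R]_n -> R) :
  partial (fun _ => 0%N) f = f.
Proof. by rewrite /partial; elim: (enum _) => //= i r ->. Qed.

Lemma partial_delta {R : realType} {n : nat} (i : 'I_n) (f : 'rV[R]_n -> R) :
  partial (fun j => (j == i) : nat) f = 'D_(delta_mx 0 i) f.
Proof.
rewrite /partial.
suff -> : flatten [seq nseq (j == i) j | j <- enum 'I_n] = [:: i] by [].
have : i \in enum 'I_n by rewrite mem_enum.
have : uniq (enum 'I_n) by exact: enum_uniq.
elim: (enum _) => //= j r IH /andP[jr ur]; rewrite inE.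
have [-> _|ij] := eqVneq i j; last by move=> /IH; apply.
rewrite -[RHS]cats0 /=; congr (_ :: _).
elim: r jr {IH ur} => //= k r IH; rewrite inE negb_or => /andP[jk jr].
by rewrite [k == _]eq_sym (negbTE jk) /= IH.
Qed.

(** O-estimates involve the absolute value of [sup_on K f].  For empty [K] the
    bound holds because the supremum of the empty set is 0. *)
Lemma norm_sup_on_le {R : realType} {n : nat} (K : set 'rV[R]_n)
    (f : 'rV[R]_n -> R) (M : R) :
  0 <= M -> (forall x, K x -> `|f x| <= M) -> `|sup_on K f| <= M.
Proof.
move=> M0 fM; rewrite /sup_on.
have [[x Kx]|K0] := pselect (K !=set0); last first.
  suff -> : [set `|f x| | x in K] = set0 by rewrite sup0 normr0.
  by rewrite -subset0 => y [x Kx _]; apply: K0; exists x.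
have ubM : ubound [set `|f x| | x in K] M by move=> _ [y Ky <-]; exact: fM.
rewrite ger0_norm.
  by apply: ge_sup => //; exists `|f x|, x.
apply: (le_trans (normr_ge0 (f x))); apply: ub_le_sup; last by exists x.
by exists M.
Qed.

Lemma le_norm_sup_on {R : realType} {n : nat} (K : set 'rV[R]_n)
    (f : 'rV[R]_n -> R) (x : 'rV[R]_n) :
  compact K -> (forall y, K y -> {for y, continuous f}) -> K x ->
  `|f x| <= `|sup_on K f|.
Proof.
move=> cK cf Kx; apply: le_trans (ler_norm _); apply: ub_le_sup.
  have : compact (f @` K).
    apply: continuous_compact => //.
    by apply: continuous_in_subspaceT => y /set_mem; exact: cf.
  move=> /compact_bounded [M [_ MP]]; exists (M + 1) => _ [y Ky <-].
  by apply: (MP (M + 1)); [rewrite ltrDl|exists y].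
by exists x.
Qed.

Lemma sup_on_attained {R : realType} {n : nat} (K : set 'rV[R]_n)
    (f : 'rV[R]_n -> R) :
  compact K -> (forall y, K y -> {for y, continuous f}) -> K !=set0 ->
  exists2 x, K x & `|sup_on K f| <= `|f x|.
Proof.
move=> cK cf K0.
have [|c /set_mem Kc cP] := @compact_EVT_max _ _ (fun y => `|f y|) K K0 cK.
  apply: continuous_in_subspaceT => y /set_mem Ky.
  by apply: continuous_comp; [exact: cf|exact: norm_continuous].
exists c => //; apply: norm_sup_on_le => // x Kx.
by apply: cP; exact/mem_set.
Qed.

(** * Small indices *)

(** [P] holds for all sufficiently small indices of the section of [A] at
    [a]. *)
Definition eventually_below {d : Order.disp_t} {I : preorderType d}
    (A : set I) (a : I) (P : I -> Prop) : Prop :=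
  exists2 e0, below A a e0 & forall e, below A e0 e -> P e.

Lemma eventually_belowI {d : Order.disp_t} {I : preorderType d}
    (cI : set (set I)) (A : set I) (a : I) (P Q : I -> Prop) :
  index_set cI -> cI A -> A a ->
  eventually_below A a P -> eventually_below A a Q ->
  eventually_below A a (fun e => P e /\ Q e).
Proof.
move=> HI IA Aa [b bA bP] [c cA cQ].
have [x [xA [xb _] [xc _]]] := index_directed HI IA Aa (lexx a) bA cA.
exists x => // e [Ae ex]; split.
  by apply: bP; split => //; exact: le_trans xb.
by apply: cQ; split => //; exact: le_trans xc.
Qed.

Lemma eventually_below_subset {d : Order.disp_t} {I : preorderType d}
    (cI : set (set I)) (A C : set I) (a : I) (P : I -> Prop) :
  index_set cI -> cI C -> C a -> C `<=` A ->
  eventually_below A a P -> eventually_below C a P.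
Proof.
move=> HI IC Ca CA [b [Ab ba] bP].
have [c [Cc cb]] := index_below HI IC Ca ba.
exists c; first by split => //; exact: le_trans ba.
by move=> e [Ce ec]; apply: bP; split; [exact: CA|exact: le_trans cb].
Qed.

Lemma eventually_belowS {d : Order.disp_t} {I : preorderType d}
    (A : set I) (a : I) (P Q : I -> Prop) :
  (forall e, P e -> Q e) -> eventually_below A a P -> eventually_below A a Q.
Proof. by move=> PQ [b bA bP]; exists b => // e /bP /PQ. Qed.

Lemma directed_subfamily_refl {d : Order.disp_t} {I : preorderType d}
    (cI : set (set I)) : index_set cI -> directed_subfamily cI cI.
Proof.
move=> HI; split => //; first by exists setT; exact: index_full HI.
exact: index_meet HI.
Qed.

(** The index [e0] in [for_small] need not belong to [A]; it can always be
    chosen there. *)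
Lemma for_smallP {d : Order.disp_t} {I : preorderType d}
    (cI F : set (set I)) (P : I -> Prop) :
  index_set cI -> F `<=` cI ->
  for_small F P <->
  exists2 A, F A & forall a, A a -> eventually_below A a P.
Proof.
move=> HI FI; split=> -[A FA AP]; exists A => // a /[dup] Aa /AP.
  move=> [b ba bP]; have [c [Ac cb]] := index_below HI (FI _ FA) Aa ba.
  exists c; first by split => //; exact: le_trans ba.
  by move=> e [Ae ec]; apply: bP; split => //; exact: le_trans cb.
by move=> [b [_ ba] bP]; exists b.
Qed.

Lemma for_smallT {d : Order.disp_t} {I : preorderType d}
    (F : set (set I)) (P : I -> Prop) :
  F !=set0 -> (forall e, P e) -> for_small F P.
Proof. by move=> [A FA] PT; exists A => // a Aa; exists a. Qed.

Lemma for_smallS {d : Order.disp_t} {I : preorderType d}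
    (F G : set (set I)) (P Q : I -> Prop) :
  F `<=` G -> (forall e, P e -> Q e) -> for_small F P -> for_small G Q.
Proof.
move=> FG PQ [A /FG GA AP]; exists A => // a /AP [b ba bP].
by exists b => // e /bP /PQ.
Qed.

Lemma for_smallI {d : Order.disp_t} {I : preorderType d}
    (cI F : set (set I)) (P Q : I -> Prop) :
  index_set cI -> directed_subfamily cI F ->
  for_small F P -> for_small F Q -> for_small F (fun e => P e /\ Q e).
Proof.
move=> HI [FI _ Fmeet] /(for_smallP _ HI FI)[A FA AP].
move=> /(for_smallP _ HI FI)[B FB BQ].
apply/(for_smallP _ HI FI).
have [C FC CAB] := Fmeet _ _ FA FB; exists C => // a Ca.
have [Aa Ba] := CAB _ Ca.
apply: (eventually_belowI HI (FI _ FC) Ca).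
  apply: (eventually_below_subset HI (FI _ FC) Ca _ (AP _ Aa)).
  by move=> e /CAB [].
apply: (eventually_below_subset HI (FI _ FC) Ca _ (BQ _ Ba)).
by move=> e /CAB [].
Qed.

Lemma for_small_witness {d : Order.disp_t} {I : preorderType d}
    (cI F : set (set I)) (P : I -> Prop) :
  index_set cI -> F `<=` cI -> for_small F P -> exists e, P e.
Proof.
move=> HI FI [A FA AP].
have [a Aa] : A !=set0.
  apply/set0P/eqP => A0; apply: (index_no_set0 HI).
  by rewrite -A0; exact: FI.
have [b ba bP] := AP a Aa.
have [c cb] := index_below HI (FI _ FA) Aa ba.
by exists c; exact: bP.
Qed.

(** * Calculus of O-estimates *)

(** Combination principle for O-estimates: a pointwise bound, valid for small
    indices and in which the constants may depend on those of two given
    estimates, yields an O-estimate.  Such a dependence is allowed because the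
    constants vary with [a]. *)
Lemma is_bigO2 {R : realType} {d : Order.disp_t} {I : preorderType d}
    {V1 V2 V : normedModType R} (cI F : set (set I)) (P : I -> Prop)
    (x1 : I -> V1) (x2 : I -> V2) (x : I -> V) (y1 y2 y : I -> R) :
  index_set cI -> directed_subfamily cI F -> for_small F P ->
  is_bigO F x1 y1 -> is_bigO F x2 y2 ->
  (forall H1 H2, 0 < H1 -> 0 < H2 -> exists2 H, 0 < H & forall e, P e ->
     `|x1 e| <= H1 * `|y1 e| -> `|x2 e| <= H2 * `|y2 e| ->
     `|x e| <= H * `|y e|) ->
  is_bigO F x y.
Proof.
move=> HI [FI _ Fmeet] /(for_smallP _ HI FI)[A FA AP] [A1 FA1 O1] [A2 FA2 O2].
move=> comb.
have [B FB BA] := Fmeet _ _ FA1 FA2.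
have [C FC CAB] := Fmeet _ _ FA FB.
exists C => // a Ca; have [Aa Ba] := CAB _ Ca; have [A1a A2a] := BA _ Ba.
have [H1 H1_gt0 E1] := O1 a A1a; have [H2 H2_gt0 E2] := O2 a A2a.
have [H H_gt0 HP] := comb _ _ H1_gt0 H2_gt0; exists H => //.
have CA : C `<=` A by move=> e /CAB [].
have CA1 : C `<=` A1 by move=> e /CAB [_ /BA []].
have CA2 : C `<=` A2 by move=> e /CAB [_ /BA []].
have IC := FI _ FC.
apply: eventually_belowS (eventually_belowI HI IC Ca
  (eventually_below_subset HI IC Ca CA (AP _ Aa))
  (eventually_belowI HI IC Ca
    (eventually_below_subset HI IC Ca CA1 E1)
    (eventually_below_subset HI IC Ca CA2 E2))).
by move=> e [Pe [+ +]]; exact: HP.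
Qed.

Lemma is_bigO1 {R : realType} {d : Order.disp_t} {I : preorderType d}
    {V1 V : normedModType R} (cI F : set (set I)) (P : I -> Prop)
    (x1 : I -> V1) (x : I -> V) (y1 y : I -> R) :
  index_set cI -> directed_subfamily cI F -> for_small F P ->
  is_bigO F x1 y1 ->
  (forall H1, 0 < H1 -> exists2 H, 0 < H & forall e, P e ->
     `|x1 e| <= H1 * `|y1 e| -> `|x e| <= H * `|y e|) ->
  is_bigO F x y.
Proof.
move=> HI HF FP O1 comb; apply: (is_bigO2 HI HF FP O1 O1) => H1 H2 H1_gt0 _.
by have [H H_gt0 HP] := comb _ H1_gt0; exists H => // e Pe x1e _; exact: HP.
Qed.

Lemma is_bigO_subset {R : realType} {d : Order.disp_t} {I : preorderType d}
    {V : normedModType R} (F G : set (set I)) (x : I -> V) (y : I -> R) :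
  F `<=` G -> is_bigO F x y -> is_bigO G x y.
Proof. by move=> FG [A /FG]; exists A. Qed.

Lemma is_bigO_le {R : realType} {d : Order.disp_t} {I : preorderType d}
    {V : normedModType R} (cI F : set (set I)) (x : I -> V) (y : I -> R)
    (c : R) :
  directed_subfamily cI F -> 0 < c -> (forall e, `|x e| <= c * `|y e|) ->
  is_bigO F x y.
Proof.
move=> [_ [A FA] _] c0 xy; exists A => // a Aa; exists c => //.
by exists a => // ; split.
Qed.

Lemma is_bigOD {R : realType} {d : Order.disp_t} {I : preorderType d}
    {V1 V2 V : normedModType R} (cI F : set (set I)) (P : I -> Prop)
    (x1 : I -> V1) (x2 : I -> V2) (x : I -> V) (y : I -> R) :
  index_set cI -> directed_subfamily cI F -> for_small F P ->
  is_bigO F x1 y -> is_bigO F x2 y ->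
  (forall e, P e -> `|x e| <= `|x1 e| + `|x2 e|) ->
  is_bigO F x y.
Proof.
move=> HI HF FP O1 O2 xP.
apply: (is_bigO2 HI HF FP O1 O2) => H1 H2 H1_gt0 H2_gt0.
exists (H1 + H2); first exact: addr_gt0.
by move=> e /xP xe x1e x2e; rewrite mulrDl (le_trans xe)// lerD.
Qed.

Lemma ler_exprV {R : realType} (r : R) (N M : nat) :
  0 < r <= 1 -> (N <= M)%N -> r ^- N <= r ^- M.
Proof.
move=> /andP[r0 r1] NM; rewrite lef_pV2 ?posrE ?exprn_gt0//.
by apply: ler_wiXn2l => //; exact: ltW.
Qed.

Lemma is_bigO_exprV {R : realType} {d : Order.disp_t} {I : preorderType d}
    {V : normedModType R} (cI F : set (set I)) (rho : I -> R) (N M : nat)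
    (x : I -> V) :
  index_set cI -> directed_subfamily cI F -> gauge cI rho -> (N <= M)%N ->
  is_bigO F x (fun e => rho e ^- N) -> is_bigO F x (fun e => rho e ^- M).
Proof.
move=> HI HF [rho01 _] NM O1; have F0 : F !=set0 by case: HF.
apply: (is_bigO1 HI HF (for_smallT F0 (fun=> Logic.I)) O1) => H1 H1_gt0.
exists H1 => // e _ /le_trans -> //.
have /andP[r0 _] := rho01 e.
rewrite ler_wpM2l ?(ltW H1_gt0)// !normfV !normrX !gtr0_norm//.
exact: ler_exprV (rho01 e) NM.
Qed.

Lemma is_bigO_exprV_sum {R : realType} {d : Order.disp_t}
    {I : preorderType d} {T : Type} (cI F : set (set I)) (rho : I -> R)
    (g : T -> I -> R) (r : seq T) :
  index_set cI -> directed_subfamily cI F -> gauge cI rho ->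
  (forall i, exists N : nat, is_bigO F (g i) (fun e => rho e ^- N)) ->
  exists N : nat,
    is_bigO F (fun e => \sum_(i <- r) `|g i e|) (fun e => rho e ^- N).
Proof.
move=> HI HF Hrho gN; have F0 : F !=set0 by case: HF.
elim: r => [|i r [N IH]].
  exists 0%N; apply: (is_bigO_le HF ltr01) => e.
  by rewrite big_nil normr0 mulr_ge0.
have [M OM] := gN i; exists (N + M)%N.
have IH' := is_bigO_exprV HI HF Hrho (leq_addr M N) IH.
have OM' := is_bigO_exprV HI HF Hrho (leq_addl N M) OM.
apply: (is_bigOD HI HF (for_smallT F0 (fun=> Logic.I)) OM' IH') => e _.
by rewrite big_cons (le_trans (ler_normD _ _))// normr_id.
Qed.

(** This is the only place where the convergence of the gauge to 0 is used. *)
Lemma bigO_rho_small {R : realType} {d : Order.disp_t} {I : preorderType d}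
    {V : normedModType R} (cI : set (set I)) (rho : I -> R) (x : I -> V)
    (r : R) :
  index_set cI -> gauge cI rho -> 0 < r ->
  is_bigO cI x (fun e => rho e ^+ 1) -> for_small cI (fun e => `|x e| <= r).
Proof.
move=> HI Hrho r0 [A IA O1].
have [[rho01 _] HF] := (Hrho, directed_subfamily_refl HI).
have [B IB rhoB] := Hrho.2.
have [C IC CAB] := index_meet HI IA IB.
apply/(for_smallP _ HI (@subset_refl _ _)); exists C => // a Ca.
have [Aa Ba] := CAB _ Ca.
have [H H_gt0 E1] := O1 a Aa.
(* [`|x e| <= H * rho e], which is at most [r] once [rho e < r / H]. *)
have E2 : eventually_below B a (fun e => rho e < r / H).
  have rH : 0 < r / H by rewrite divr_gt0.
  have [b bB bP] := rhoB a Ba (ball 0 (r / H)) (nbhsx_ballx (0 : R) _ rH).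
  exists b => // e /bP /=; rewrite -ball_normE/= sub0r normrN.
  exact/le_lt_trans/ler_norm.
have CA : C `<=` A by move=> e /CAB [].
have CB : C `<=` B by move=> e /CAB [].
apply: eventually_belowS (eventually_belowI HI IC Ca
  (eventually_below_subset HI IC Ca CA E1)
  (eventually_below_subset HI IC Ca CB E2)).
move=> e [xe]; have /andP[re _] := rho01 e.
rewrite ltr_pdivlMr// mulrC => /ltW; apply: le_trans.
by rewrite expr1 gtr0_norm in xe.
Qed.

(** * Equivalence of nets of points *)

Lemma equiv_point_refl {R : realType} {d : Order.disp_t} {I : preorderType d}
    {V : normedModType R} (cI : set (set I)) (rho : I -> R) (x : I -> V) :
  index_set cI -> equiv_point cI rho x x.
Proof.
move=> HI m; apply: (is_bigO_le (directed_subfamily_refl HI) ltr01) => e.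
by rewrite subrr normr0 mulr_ge0.
Qed.

Lemma equiv_point_sym {R : realType} {d : Order.disp_t} {I : preorderType d}
    {V : normedModType R} (cI : set (set I)) (rho : I -> R) (x y : I -> V) :
  equiv_point cI rho x y -> equiv_point cI rho y x.
Proof.
move=> xy m; have [A IA AP] := xy m; exists A => // a /AP [H H0 [b bA bP]].
by exists H => //; exists b => // e; rewrite distrC; exact: bP.
Qed.

Lemma equiv_point_trans {R : realType} {d : Order.disp_t}
    {I : preorderType d} {V : normedModType R} (cI : set (set I))
    (rho : I -> R) (x y z : I -> V) :
  index_set cI -> equiv_point cI rho x y -> equiv_point cI rho y z ->
  equiv_point cI rho x z.
Proof.
move=> HI xy yz m; have HF := directed_subfamily_refl HI.
have I0 : cI !=set0 by case: HF.
apply: (is_bigOD HI HF (for_smallT I0 (fun=> Logic.I)) (xy m) (yz m)) => e _.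
by rewrite -(subrKA (y e)) ler_normD.
Qed.

Lemma equiv_point_eventually_eq {R : realType} {d : Order.disp_t}
    {I : preorderType d} {V : normedModType R} (cI : set (set I))
    (rho : I -> R) (x y : I -> V) :
  index_set cI -> for_small cI (fun e => x e = y e) -> equiv_point cI rho x y.
Proof.
move=> HI xy m.
apply: (is_bigO1 HI (directed_subfamily_refl HI) xy
  (equiv_point_refl rho x HI m)) => H H0.
by exists H => // e -> _; rewrite subrr normr0 mulr_ge0// ltW.
Qed.

Lemma point_class_eq {R : realType} {d : Order.disp_t} {I : preorderType d}
    {V : normedModType R} (cI cJ : set (set I)) (rho : I -> R) (D : set V)
    (x y : I -> V) :
  index_set cI -> equiv_point cI rho x y ->
  point_class cI cJ rho D x = point_class cI cJ rho D y.
Proof.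
move=> HI xy; apply/seteqP; split => z [Mz xz]; split => //.
  exact: equiv_point_trans (equiv_point_sym xy) xz.
exact: equiv_point_trans xy xz.
Qed.

(** * Moderate and negligible nets of functions *)

Lemma moderate_fun0 {R : realType} {n : nat} {d : Order.disp_t}
    {I : preorderType d} (cI cJ : set (set I)) (rho : I -> R)
    (Omega : set 'rV[R]_n) (Omegae : I -> set 'rV[R]_n)
    (u : I -> 'rV[R]_n -> R) :
  directed_subfamily cI cJ -> moderate_fun cJ rho Omega Omegae u ->
  moderate_fun cJ rho Omega Omegae (fun _ _ => 0).
Proof.
move=> HJ [_ uM]; split=> [e|K KO]; first exact: smooth_on0.
have [Ksmall _] := uM K KO; split=> // alpha; exists 0%N.
apply: (is_bigO_le HJ ltr01) => e.
rewrite /partial iter_partial0; apply: norm_sup_on_le.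
  by rewrite mulr_ge0.
by move=> x _; rewrite normr0 mulr_ge0.
Qed.

Lemma negligible_fun0 {R : realType} {n : nat} {d : Order.disp_t}
    {I : preorderType d} (cI cJ : set (set I)) (rho : I -> R)
    (Omega : set 'rV[R]_n) (Omegae : I -> set 'rV[R]_n)
    (u : I -> 'rV[R]_n -> R) :
  index_set cI -> directed_subfamily cI cJ ->
  moderate_fun cJ rho Omega Omegae u ->
  negligible_fun cI cJ rho Omega Omegae (fun _ _ => 0).
Proof.
move=> HI HJ uM; split; first exact: moderate_fun0 HJ uM.
move=> K KO m; apply: (is_bigO_le (directed_subfamily_refl HI) ltr01) => e.
apply: norm_sup_on_le; first by rewrite mulr_ge0.
by move=> x _; rewrite normr0 mulr_ge0.
Qed.

Lemma moderate_funB {R : realType} {n : nat} {d : Order.disp_t}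
    {I : preorderType d} (cI cJ : set (set I)) (rho : I -> R)
    (Omega : set 'rV[R]_n) (Omegae : I -> set 'rV[R]_n)
    (u v : I -> 'rV[R]_n -> R) :
  index_set cI -> directed_subfamily cI cJ -> gauge cI rho ->
  (forall e, open (Omegae e)) ->
  moderate_fun cJ rho Omega Omegae u -> moderate_fun cJ rho Omega Omegae v ->
  moderate_fun cJ rho Omega Omegae (fun e y => u e y - v e y).
Proof.
move=> HI HJ Hrho oO [su uM] [sv vM]; split=> [e|K KO]; first exact: smooth_onB.
have [Ksmall uK] := uM K KO; have [_ vK] := vM K KO.
split=> // alpha; have [N uN] := uK alpha; have [M vMM] := vK alpha.
exists (maxn N M).
apply: (is_bigOD HI HJ Ksmall
  (is_bigO_exprV HI HJ Hrho (leq_maxl N M) uN)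
  (is_bigO_exprV HI HJ Hrho (leq_maxr N M) vMM)) => e KOe.
apply: norm_sup_on_le; first exact: addr_ge0.
move=> x Kx; rewrite /partial (iter_partialB _ (oO e) (su e) (sv e) (KOe _ Kx)).
rewrite (le_trans (ler_normB _ _))// lerD// le_norm_sup_on//.
- exact: KO.1.
- exact: smooth_on_continuous (su e) KOe.
- exact: KO.1.
- exact: smooth_on_continuous (sv e) KOe.
Qed.

Lemma negligible_funB {R : realType} {n : nat} {d : Order.disp_t}
    {I : preorderType d} (cI cJ : set (set I)) (rho : I -> R)
    (Omega : set 'rV[R]_n) (Omegae : I -> set 'rV[R]_n)
    (u v : I -> 'rV[R]_n -> R) :
  index_set cI -> directed_subfamily cI cJ -> gauge cI rho ->
  (forall e, open (Omegae e)) ->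
  negligible_fun cI cJ rho Omega Omegae u ->
  negligible_fun cI cJ rho Omega Omegae v ->
  negligible_fun cI cJ rho Omega Omegae (fun e y => u e y - v e y).
Proof.
move=> HI HJ Hrho oO [uM uN] [vM vN]; split.
  exact: moderate_funB HI HJ Hrho oO uM vM.
move=> K KO m; have [JI _ _] := HJ.
have [su /(_ K KO)[Ksmall _]] := uM; have [sv _] := vM.
apply: (is_bigOD HI (directed_subfamily_refl HI)
  (for_smallS JI (fun _ => id) Ksmall) (uN K KO m) (vN K KO m)) => e KOe.
apply: norm_sup_on_le; first exact: addr_ge0.
move=> x Kx; rewrite (le_trans (ler_normB _ _))// lerD// le_norm_sup_on//.
- exact: KO.1.
- exact: (smooth_on_continuous (s := [::]) (su e) KOe).
- exact: KO.1.
- exact: (smooth_on_continuous (s := [::]) (sv e) KOe).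
Qed.

Lemma fun_class_refl {R : realType} {n : nat} {d : Order.disp_t}
    {I : preorderType d} (cI cJ : set (set I)) (rho : I -> R)
    (Omega : set 'rV[R]_n) (Omegae : I -> set 'rV[R]_n)
    (u : I -> 'rV[R]_n -> R) :
  index_set cI -> directed_subfamily cI cJ ->
  moderate_fun cJ rho Omega Omegae u ->
  fun_class cI cJ rho Omega Omegae u u.
Proof.
move=> HI HJ uM; split => //.
rewrite (_ : (fun e y => _) = (fun _ _ => 0)).
  exact: negligible_fun0 HI HJ uM.
by apply/funext => e; apply/funext => y; rewrite subrr.
Qed.

Lemma fun_class_eq {R : realType} {n : nat} {d : Order.disp_t}
    {I : preorderType d} (cI cJ : set (set I)) (rho : I -> R)
    (Omega : set 'rV[R]_n) (Omegae : I -> set 'rV[R]_n)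
    (u v : I -> 'rV[R]_n -> R) :
  index_set cI -> directed_subfamily cI cJ -> gauge cI rho ->
  (forall e, open (Omegae e)) ->
  negligible_fun cI cJ rho Omega Omegae (fun e y => u e y - v e y) ->
  fun_class cI cJ rho Omega Omegae u = fun_class cI cJ rho Omega Omegae v.
Proof.
move=> HI HJ Hrho oO.
suff sub (f g : I -> 'rV[R]_n -> R) :
    negligible_fun cI cJ rho Omega Omegae (fun e y => f e y - g e y) ->
    fun_class cI cJ rho Omega Omegae g `<=` fun_class cI cJ rho Omega Omegae f.
  move=> uvN; apply/seteqP; split; apply: sub => //.
  have := negligible_funB HI HJ Hrho oO (negligible_fun0 HI HJ uvN.1) uvN.
  rewrite (_ : (fun e y => _) = (fun e y => v e y - u e y))//.
  by apply/funext => e; apply/funext => y; rewrite sub0r opprB.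
move=> fgN w [wM wgN]; split => //.
have := negligible_funB HI HJ Hrho oO wgN fgN.
rewrite (_ : (fun e y => _) = (fun e y => w e y - f e y))//.
by apply/funext => e; apply/funext => y; rewrite opprB subrKA.
Qed.

(** * Point values *)

Lemma moderate_point_compact {R : realType} {d : Order.disp_t}
    {I : preorderType d} {V : normedModType R} (cI cJ : set (set I))
    (rho : I -> R) (D K : set V) (x : I -> V) :
  directed_subfamily cI cJ -> compact K -> K `<=` D -> (forall e, K (x e)) ->
  moderate_point cJ rho D x.
Proof.
move=> HJ /compact_bounded[M [_ MP]] KD Kx.
split=> [e|]; first exact/KD/Kx.
have M0 : 0 < `|M| + 1 by rewrite ltr_wpDl.
exists 0%N; apply: (is_bigO_le HJ M0) => e.
 rewrite expr0 invr1 normr1 mulr1; apply: (MP (`|M| + 1)); last exact: Kx.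
by rewrite ltr_pwDr// ler_norm.
Qed.

(** The representative is redefined to be a fixed point of [K] at the indices
    where it does not lie in [K]; this does not affect its class. *)
Lemma compact_pointsP {R : realType} {n : nat} {d : Order.disp_t}
    {I : preorderType d} (cI cJ : set (set I)) (rho : I -> R)
    (Omega : set 'rV[R]_n) (X : set (I -> 'rV[R]_n)) :
  index_set cI -> directed_subfamily cI cJ ->
  compact_points cI cJ rho Omega X ->
  exists2 K, compact_in K Omega & exists2 x, (forall e, K (x e)) &
    X = point_class cI cJ rho Omega x.
Proof.
move=> HI HJ [x [_ -> [K KO Kx]]]; exists K => //.
have [e0 Kk] := for_small_witness HI (@subset_refl _ _) Kx.
pose x1 e := if pselect (K (x e)) then x e else x e0.
exists x1 => [e|]; first by rewrite /x1; case: pselect.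
apply: point_class_eq => //; apply: equiv_point_eventually_eq => //.
by apply: for_smallS Kx => // e Kxe; rewrite /x1; case: pselect.
Qed.

Lemma moderate_eval_net {R : realType} {n : nat} {d : Order.disp_t}
    {I : preorderType d} (cI cJ : set (set I)) (rho : I -> R)
    (Omega : set 'rV[R]_n) (Omegae : I -> set 'rV[R]_n)
    (K : set 'rV[R]_n) (u : I -> 'rV[R]_n -> R) (x : I -> 'rV[R]_n) :
  index_set cI -> directed_subfamily cI cJ ->
  moderate_fun cJ rho Omega Omegae u -> compact_in K Omega ->
  (forall e, K (x e)) -> moderate_point cJ rho [set: R] (eval_net u x).
Proof.
move=> HI HJ [su uM] KO Kx; split => //.
have [Ksmall /(_ (fun=> 0%N))[N uN]] := uM K KO; exists N.
apply: (is_bigO1 HI HJ Ksmall uN) => H H0; exists H => // e KOe.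
rewrite partial_nil; apply: le_trans.
apply: le_norm_sup_on => //; first exact: KO.1.
exact: (smooth_on_continuous (s := [::]) (su e) KOe).
Qed.

Lemma negligible_eval_net {R : realType} {n : nat} {d : Order.disp_t}
    {I : preorderType d} (cI cJ : set (set I)) (rho : I -> R)
    (Omega : set 'rV[R]_n) (Omegae : I -> set 'rV[R]_n)
    (L : set 'rV[R]_n) (u : I -> 'rV[R]_n -> R) (x : I -> 'rV[R]_n) (m : nat) :
  index_set cI -> directed_subfamily cI cJ ->
  negligible_fun cI cJ rho Omega Omegae u -> compact_in L Omega ->
  for_small cI (fun e => L (x e)) ->
  is_bigO cI (eval_net u x) (fun e => rho e ^+ m).
Proof.
move=> HI HJ [[su uM] uN] LO Lx; have HF := directed_subfamily_refl HI.
have [JI _ _] := HJ; have [Lsmall _] := uM L LO.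
apply: (is_bigO1 HI HF (for_smallI HI HF Lx
  (for_smallS JI (fun _ => id) Lsmall)) (uN L LO m)) => H H0.
exists H => // e [Lxe LOe]; apply: le_trans.
apply: le_norm_sup_on => //; first exact: LO.1.
exact: (smooth_on_continuous (s := [::]) (su e) LOe).
Qed.

Lemma eval_net_equiv_point {R : realType} {n : nat} {d : Order.disp_t}
    {I : preorderType d} (cI cJ : set (set I)) (rho : I -> R)
    (Omega : set 'rV[R]_n) (Omegae : I -> set 'rV[R]_n)
    (K : set 'rV[R]_n) (u : I -> 'rV[R]_n -> R) (x y : I -> 'rV[R]_n) :
  index_set cI -> directed_subfamily cI cJ -> gauge cI rho -> open Omega ->
  moderate_fun cJ rho Omega Omegae u -> compact_in K Omega ->
  (forall e, K (x e)) -> equiv_point cI rho y x ->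
  equiv_point cI rho (eval_net u y) (eval_net u x).
Proof.
move=> HI HJ Hrho oO [su uM] KO Kx yx m; have HF := directed_subfamily_refl HI.
have [JI _ _] := HJ.
have [r r0 [L LO KL]] := compact_thickening oO KO.
have [Lsmall uL] := uM L LO.
have [|N DN] := @is_bigO_exprV_sum _ _ _ _ cI cI rho
  (fun i e => sup_on L ('D_(delta_mx 0 i) (u e))) (enum 'I_n) HI HF Hrho.
  move=> i; have [N uN] := uL (fun j => (j == i) : nat); exists N.
  move/(is_bigO_subset JI): uN.
  by congr is_bigO; apply/funext => e; rewrite partial_delta.
(* The loss [rho^-N] from the derivatives is compensated by using the
   equivalence of [y] and [x] at order [N + m]. *)
apply: (is_bigO2 HI HF (for_smallI HI HF
  (bigO_rho_small HI Hrho r0 (yx 1%N))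
  (for_smallS JI (fun _ => id) Lsmall)) DN (yx (N + m)%N)) => H1 H2 H10 H20.
exists (H1 * H2); first exact: mulr_gt0.
move=> e [yxr LOe] DH yxH.
have Lball z : `|z - x e| <= `|y e - x e| -> L z.
  by move=> zx; apply: (KL (x e)) => //; exact: le_trans yxr.
have mv := @coordinatewise_mean_value _ _ (u e) (x e) (y e)
  (fun i => `|sup_on L ('D_(delta_mx 0 i) (u e))|).
apply: (le_trans (mv _)).
  move=> z /Lball Lz i; split.
    by have [_ /(_ i)] := su e [::] z (LOe z Lz).
  apply: (@le_norm_sup_on _ _ L ('D_(delta_mx 0 i) (u e))) => //.
    exact: LO.1.
  exact: (smooth_on_continuous (s := [:: i]) (su e) LOe).
rewrite big_enum/= ger0_norm ?sumr_ge0// in DH.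
apply: (le_trans (ler_pM _ _ DH yxH)) => //; first exact: sumr_ge0.
have [/(_ e)/andP[re _] _] := Hrho.
rewrite mulrACA -normrM exprD mulKf// expf_neq0//.
exact: lt0r_neq0.
Qed.

Lemma eval_net_well_defined {R : realType} {n : nat} {d : Order.disp_t}
    {I : preorderType d} (cI cJ : set (set I)) (rho : I -> R)
    (Omega : set 'rV[R]_n) (Omegae : I -> set 'rV[R]_n)
    (K : set 'rV[R]_n) (u v : I -> 'rV[R]_n -> R) (x y : I -> 'rV[R]_n) :
  index_set cI -> directed_subfamily cI cJ -> gauge cI rho -> open Omega ->
  moderate_fun cJ rho Omega Omegae u -> compact_in K Omega ->
  (forall e, K (x e)) ->
  fun_class cI cJ rho Omega Omegae u v -> point_class cI cJ rho Omega x y ->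
  equiv_point cI rho (eval_net v y) (eval_net u x).
Proof.
move=> HI HJ Hrho oO uM KO Kx [vM vuN] [_ /equiv_point_sym yx].
have uyx := eval_net_equiv_point HI HJ Hrho oO uM KO Kx yx.
apply: equiv_point_trans uyx => // m.
have [r r0 [L LO KL]] := compact_thickening oO KO.
have Ly : for_small cI (fun e => L (y e)).
  by apply: for_smallS (bigO_rho_small HI Hrho r0 (yx 1%N)) => // e; exact: KL.
exact: negligible_eval_net HI HJ vuN LO Ly.
Qed.

(** The value of the class of [u] at the class of [x] is the class of the net
    [u e (x e)]. *)
Lemma is_value_class {R : realType} {n : nat} {d : Order.disp_t}
    {I : preorderType d} (cI cJ : set (set I)) (rho : I -> R)
    (Omega : set 'rV[R]_n) (Omegae : I -> set 'rV[R]_n)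
    (K : set 'rV[R]_n) (u : I -> 'rV[R]_n -> R) (x : I -> 'rV[R]_n) :
  index_set cI -> directed_subfamily cI cJ -> gauge cI rho -> open Omega ->
  moderate_fun cJ rho Omega Omegae u -> compact_in K Omega ->
  (forall e, K (x e)) ->
  is_value cI cJ rho (fun_class cI cJ rho Omega Omegae u)
    (point_class cI cJ rho Omega x) (real_class cI cJ rho (eval_net u x)).
Proof.
move=> HI HJ Hrho oO uM KO Kx; split.
  exists u, x; split; first exact: fun_class_refl.
    by split; [exact: moderate_point_compact HJ KO.1 KO.2 Kx
              |exact: equiv_point_refl].
  exact: moderate_eval_net HI HJ uM KO Kx.
move=> v y vu yx; apply: point_class_eq => //.
exact: eval_net_well_defined HI HJ Hrho oO uM KO Kx vu yx.
Qed.

Lemma is_value_unique {R : realType} {n : nat} {d : Order.disp_t}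
    {I : preorderType d} (cI cJ : set (set I)) (rho : I -> R)
    (U : set (I -> 'rV[R]_n -> R)) (X : set (I -> 'rV[R]_n))
    (Y Z : set (I -> R)) :
  is_value cI cJ rho U X Y -> is_value cI cJ rho U X Z -> Y = Z.
Proof. by move=> [[u [x [Uu Xx _]]] /(_ u x Uu Xx) <-] [_ ->]. Qed.

(** It suffices to test [u] on nets with values in a compact set. *)
Lemma negligible_of_zero_values {R : realType} {n : nat} {d : Order.disp_t}
    {I : preorderType d} (cI cJ : set (set I)) (rho : I -> R)
    (Omega : set 'rV[R]_n) (Omegae : I -> set 'rV[R]_n)
    (u : I -> 'rV[R]_n -> R) :
  index_set cI -> directed_subfamily cI cJ ->
  moderate_fun cJ rho Omega Omegae u ->
  (forall K x, compact_in K Omega -> (forall e, K (x e)) ->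
     equiv_point cI rho (eval_net u x) (fun _ => 0)) ->
  negligible_fun cI cJ rho Omega Omegae u.
Proof.
move=> HI HJ uM u0; split => // K KO m; have [JI _ _] := HJ.
have HF := directed_subfamily_refl HI.
have [[k Kk]|K0] := pselect (K !=set0); last first.
  apply: (is_bigO_le HF ltr01) => e.
  apply: norm_sup_on_le; first by rewrite mulr_ge0.
  by move=> x Kx; case: K0; exists x.
have [su /(_ K KO)[Ksmall _]] := uM.
(* Only the indices with [K `<=` Omegae e] matter; elsewhere [x e] is the
   arbitrary point [k] of [K]. *)
have xP e : exists x, K x /\
    (K `<=` Omegae e -> `|sup_on K (u e)| <= `|u e x|).
  have [KOe|KOe] := pselect (K `<=` Omegae e); last by exists k.
  have [|||x Kx xmax] := @sup_on_attained _ _ K (u e); last by exists x.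
  - exact: KO.1.
  - exact: (smooth_on_continuous (s := [::]) (su e) KOe).
  - by exists k.
pose x e := projT1 (cid (xP e)).
have Kx e : K (x e) by have [] := projT2 (cid (xP e)).
apply: (is_bigO1 HI HF (for_smallS JI (fun _ => id) Ksmall) (u0 K x KO Kx m)).
move=> H H0; exists H => // e KOe; rewrite subr0; apply: le_trans.
by have [_ zmax] := projT2 (cid (xP e)); exact: zmax.
Qed.

Theorem theorem37 (R : realType) (n : nat) (d : Order.disp_t)
  (I : preorderType d) (cI cJ : set (set I)) (rho : I -> R)
  (Omega : set 'rV[R]_n) (Omegae : I -> set 'rV[R]_n)
  (Omega_open : open Omega)
  (cI_index : index_set cI)
  (A1 : sequential_indices cI)
  (A2 : directed_subfamily cI cJ)
  (A3 : gauge cI rho)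
  (A4 : forall e : I, open (Omegae e))
  (U : set (I -> 'rV[R]_n -> R))
  (HU : gen_functions cI cJ rho Omega Omegae U) :
  (forall X : set (I -> 'rV[R]_n), compact_points cI cJ rho Omega X ->
     exists! Y : set (I -> R),
       gen_reals cI cJ rho Y /\ is_value cI cJ rho U X Y) /\
  (U = fun_class cI cJ rho Omega Omegae (fun _ _ => 0) <->
   forall X : set (I -> 'rV[R]_n), compact_points cI cJ rho Omega X ->
     is_value cI cJ rho U X (real_class cI cJ rho (fun _ => 0))).
Proof.
case: HU => u uM ->; split=> [X|].
  move=> /(compact_pointsP cI_index A2)[K KO [x Kx ->]].
  have val := is_value_class cI_index A2 A3 Omega_open uM KO Kx.
  exists (real_class cI cJ rho (eval_net u x)); split.
    split => //; exists (eval_net u x) => //.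
    exact: moderate_eval_net cI_index A2 uM KO Kx.
  by move=> Y [_]; exact: is_value_unique.
split=> [-> X|val0].
  move=> /(compact_pointsP cI_index A2)[K KO [x Kx ->]].
  exact: (is_value_class cI_index A2 A3 Omega_open (moderate_fun0 A2 uM) KO Kx).
apply: fun_class_eq => //.
rewrite (_ : (fun e y => _) = u); last first.
  by apply/funext => e; apply/funext => y; rewrite subr0.
apply: (negligible_of_zero_values cI_index A2 uM) => K x KO Kx.
have Xc : compact_points cI cJ rho Omega (point_class cI cJ rho Omega x).
  exists x; split=> //; first exact: moderate_point_compact A2 KO.1 KO.2 Kx.
  by exists K => //; apply: for_smallT => //; exists setT; exact: index_full.
have E := is_value_unique (val0 _ Xc)
  (is_value_class cI_index A2 A3 Omega_open uM KO Kx).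
(* The zero net lies in the class of [eval_net u x], hence is equivalent
   to it. *)
have : real_class cI cJ rho (fun _ => 0) (fun _ => 0 : R).
  split; last exact: equiv_point_refl.
  split => //; exists 0%N; apply: (is_bigO_le A2 ltr01) => e.
  by rewrite normr0 mulr_ge0.
by rewrite E => -[].
Qed.
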